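(* Let $(\rho,u,\theta,q,S)$ be a local solution of the system (NS). Then the entropy $$\eta:=C_v\ln\theta-R\ln\rho-\left(\frac{Z(\theta)}{2\theta}\right)'q^2$$ (where $'$ denotes the derivative with respect to $\theta$) satisfies $$(\rho\eta)_t+\left(\rho u\eta+\frac{q}{\theta}\right)_x=\frac{q^2}{\kappa(\theta)\theta^2}+\frac{S^2}{\mu\theta}.$$
   Context: The system (NS) for unknowns $(\rho,u,\theta,q,S)(t,x)$, with $\rho>0$, $\theta>0$, $(t,x)\in[0,\infty)\times\mathbb R$, is $$\rho_t+(\rho u)_x=0,\qquad \rho u_t+\rho u u_x+p_x=S_x,\qquad E_t+(uE+pu+q-Su)_x=0,$$ $$\tau_1(\theta)(\rho q_t+\rho u\, q_x)+q+\kappa(\theta)\theta_x=0,\qquad \tau_2(\rho S_t+\rho u\, S_x)+S=\mu u_x,$$ with $$E=\tfrac12\rho u^2+\tfrac{\tau_2}{2\mu}\rho S^2+\rho e,\quad e=C_v\theta+a(\theta)q^2,\quad p=R\rho\theta,\quad a(\theta)=\frac{Z(\theta)}{\theta}-\frac12 Z'(\theta),\quad Z(\theta)=\frac{\tau_1(\theta)}{\kappa(\theta)}.$$ Here $\tau_2,\mu,C_v,R>0$ are constants and $\tau_1(\theta),\kappa(\theta)>0$ are (smooth) functions of $\theta>0$. Standing assumption: $a(\theta)>0$, $a'(\theta)\ge0$, $\frac12\left(\frac{Z(\theta)}{\theta}\right)'\ge0$ for all $\theta>0$. A local solution means a solution on some time interval $[0,T]$ with $(\rho-1,u,\theta-1,q,S)\in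 C^0([0,T],H^s(\mathbb R))\cap C^1([0,T],H^{s-1}(\mathbb R))$, $s\ge2$, and $\rho,\theta>0$. *)

(* Defs.v *)
From HB Require Import structures.
From mathcomp Require Import all_boot all_order all_algebra.
From mathcomp Require Import all_classical all_reals all_analysis.

Set Implicit Arguments.
Unset Strict Implicit.
Unset Printing Implicit Defensive.

Import Order.TTheory GRing.Theory Num.Theory.
Import numFieldNormedType.Exports.

Local Open Scope classical_set_scope.
Local Open Scope ring_scope.

(* Sobolev spaces H^k on the real line, k a natural number, as in Brezis,
   Functional Analysis, Sobolev Spaces and PDEs, Section 8.2: the test functions
   are C^1 with compact support, and f is in H^(k+1) when f is in L^2 and has a
   weak derivative in H^k. *)
Definition test_function (R : realType) (phi : R -> R) : Prop :=
  [/\ forall x : R, derivable phi x 1,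
      continuous (derive1 phi) &
      compact (closure [set x | phi x != 0])].

Definition weak_derivative (R : realType) (f g : R -> R) : Prop :=
  forall phi : R -> R, test_function phi ->
    (\int[@lebesgue_measure R]_x (f x * derive1 phi x) =
     - \int[@lebesgue_measure R]_x (g x * phi x))%R.

Fixpoint sobolev (R : realType) (k : nat) : set (R -> R) :=
  match k with
  | 0 => [set f | f \in Lfun (@lebesgue_measure R) 2%:E]
  | j.+1 => [set f | f \in Lfun (@lebesgue_measure R) 2%:E /\
                     exists2 g, weak_derivative f g & sobolev j g]
  end.

(* A weak derivative in L^2, unique almost everywhere; the value 0 is a dummy
   used only when there is none. *)
Definition wderiv (R : realType) (f : R -> R) : R -> R :=
  xget (cst 0) [set g | g \in Lfun (@lebesgue_measure R) 2%:E /\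
                        weak_derivative f g].

(* This is the norm of H^k on [sobolev k] only; it is meaningless elsewhere. *)
Definition sobolev_norm (R : realType) (k : nat) (f : R -> R) : \bar R :=
  (\sum_(j < k.+1) 'N[@lebesgue_measure R]_2%:E[EFin \o iter j (@wderiv R) f])%E.

(* A curve t |-> F t in H^k is a function of two variables, time first. *)
Definition C0_sobolev (R : realType) (T : R) (k : nat) (F : R -> R -> R) : Prop :=
  forall t : R, t \in `[0, T] -> sobolev k (F t) /\
    sobolev_norm k (fun x => F r x - F t x)
      @[r --> within `[0, T] (nbhs t)] --> 0%E.

Definition C1_sobolev (R : realType) (T : R) (k : nat) (F : R -> R -> R) : Prop :=
  C0_sobolev T k F /\
  exists2 G : R -> R -> R, C0_sobolev T k G &
    forall t : R, t \in `[0, T] ->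
      sobolev_norm k (fun x => (F r x - F t x) / (r - t) - G t x)
        @[r --> within `[0, T] t^'] --> 0%E.

(* Elements of H^s with s >= 1 are identified with their unique continuous
   representative, so that F can be evaluated at every point. *)
Definition regular_curve (R : realType) (T : R) (s : nat) (F : R -> R -> R) : Prop :=
  [/\ forall t : R, t \in `[0, T] -> continuous (F t),
      C0_sobolev T s F & C1_sobolev T s.-1 F].

(* Time derivative relative to [0, T], hence one-sided at the end points. *)
Definition dt_quotient (R : realType) (F : R -> R -> R) (t x : R) : R -> R :=
  fun r => (F r x - F t x) / (r - t).

Definition dt_exists (R : realType) (T : R) (F : R -> R -> R) (t x : R) : Prop :=
  cvg (dt_quotient F t x @ within `[0, T] t^').

Definition dt (R : realType) (T : R) (F : R -> R -> R) (t x : R) : R :=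
  lim (dt_quotient F t x @ within `[0, T] t^').

Definition dx (R : realType) (F : R -> R -> R) (t x : R) : R := derive1 (F t) x.

(* The gas constant is called [Rgas]. The functions tau1 and kappa of the
   temperature matter only on positive arguments. *)
Record coefficients (R : realType) := Coefficients {
  tau1 : R -> R;
  kappa : R -> R;
  tau2 : R;
  mu : R;
  Cv : R;
  Rgas : R }.

Definition Zfun (R : realType) (c : coefficients R) (th : R) : R :=
  tau1 c th / kappa c th.

Definition afun (R : realType) (c : coefficients R) (th : R) : R :=
  Zfun c th / th - 2^-1 * derive1 (Zfun c) th.

Definition smooth_on_positives (R : realType) (f : R -> R) : Prop :=
  forall (n : nat) (th : R), 0 < th -> derivable (derive1n n f) th 1.

Record admissible (R : realType) (c : coefficients R) : Prop := Admissible {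
  tau2_gt0 : 0 < tau2 c;
  mu_gt0 : 0 < mu c;
  Cv_gt0 : 0 < Cv c;
  Rgas_gt0 : 0 < Rgas c;
  tau1_gt0 : forall th, 0 < th -> 0 < tau1 c th;
  kappa_gt0 : forall th, 0 < th -> 0 < kappa c th;
  tau1_smooth : smooth_on_positives (tau1 c);
  kappa_smooth : smooth_on_positives (kappa c);
  a_gt0 : forall th, 0 < th -> 0 < afun c th;
  a_nondecreasing : forall th, 0 < th -> 0 <= derive1 (afun c) th;
  Z_over_nondecreasing : forall th, 0 < th ->
    0 <= 2^-1 * derive1 (fun y => Zfun c y / y) th }.

Definition pressure (R : realType) (c : coefficients R)
    (rho theta : R -> R -> R) (t x : R) : R :=
  Rgas c * rho t x * theta t x.

Definition internal_energy (R : realType) (c : coefficients R)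
    (theta q : R -> R -> R) (t x : R) : R :=
  Cv c * theta t x + afun c (theta t x) * q t x ^+ 2.

Definition total_energy (R : realType) (c : coefficients R)
    (rho u theta q S : R -> R -> R) (t x : R) : R :=
  2^-1 * rho t x * u t x ^+ 2
  + tau2 c / (2 * mu c) * rho t x * S t x ^+ 2
  + rho t x * internal_energy c theta q t x.

Record NS_equations (R : realType) (c : coefficients R) (T : R)
    (rho u theta q S : R -> R -> R) (t x : R) : Prop := NSEquations {
  NS_mass :
    dt T rho t x + dx (fun t x => rho t x * u t x) t x = 0;
  NS_momentum :
    rho t x * dt T u t x + rho t x * u t x * dx u t x
      + dx (pressure c rho theta) t x = dx S t x;
  NS_energy :
    dt T (total_energy c rho u theta q S) t x
      + dx (fun t x => u t x * total_energy c rho u theta q S t x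
                       + pressure c rho theta t x * u t x
                       + q t x - S t x * u t x) t x = 0;
  NS_heat_flux :
    tau1 c (theta t x)
        * (rho t x * dt T q t x + rho t x * u t x * dx q t x)
      + q t x + kappa c (theta t x) * dx theta t x = 0;
  NS_stress :
    tau2 c * (rho t x * dt T S t x + rho t x * u t x * dx S t x)
      + S t x = mu c * dx u t x }.

Record local_solution (R : realType) (c : coefficients R) (s : nat) (T : R)
    (rho u theta q S : R -> R -> R) : Prop := LocalSolution {
  sol_rho : regular_curve T s (fun t x => rho t x - 1);
  sol_u : regular_curve T s u;
  sol_theta : regular_curve T s (fun t x => theta t x - 1);
  sol_q : regular_curve T s q;
  sol_S : regular_curve T s S;
  sol_rho_gt0 : forall t x : R, t \in `[0, T] -> 0 < rho t x;
  sol_theta_gt0 : forall t x : R, t \in `[0, T] -> 0 < theta t x;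
  sol_equations : forall t x : R, t \in `[0, T] ->
    NS_equations c T rho u theta q S t x }.

Definition entropy (R : realType) (c : coefficients R)
    (rho theta q : R -> R -> R) (t x : R) : R :=
  Cv c * ln (theta t x) - Rgas c * ln (rho t x)
  - derive1 (fun th => Zfun c th / (2 * th)) (theta t x) * q t x ^+ 2.

(* Main.v *)
Require Import Defs.
From HB Require Import structures.
From mathcomp Require Import all_boot all_order all_algebra.
From mathcomp Require Import all_classical all_reals all_analysis.
From mathcomp Require Import measurable_realfun ring lra.

Import Order.TTheory GRing.Theory Num.Theory.
Import numFieldNormedType.Exports.

Local Open Scope classical_set_scope.
Local Open Scope ring_scope.

Set Implicit Arguments.
Unset Strict Implicit.

(* The entropy identity is a pointwise consequence of the five equations once
   all first derivatives exist in the classical sense, so the work is to get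
   them from Sobolev regularity. Testing a weak derivative g of f against C^1
   approximations of the indicator of [x, y] gives f y - f x = int_x^y g for all
   Lebesgue points x, y of f. Hence a continuous function in H^2 is
   differentiable, as its weak derivative agrees almost everywhere with a
   continuous primitive; and |f x| is at most the H^1 norm of f at Lebesgue
   points. The last bound, applied to differences of time quotients (continuous
   in x), shows that at each x these quotients are Cauchy as r tends to t.
   Writing D for the material derivative, the energy balance minus u times the
   momentum balance, with the stress equation, gives
   rho D e + p u_x + q_x = S^2 / mu; dividing by theta and inserting the mass
   and heat flux equations gives the entropy balance. *)

(** * C^1 approximations of indicators *)

Section Slope.
Context {R : realType}.

(** The substitution r = h + x turns the increment form of the derivative into the quotient form of
    [dt_quotient], so ordinary and one-sided derivatives can be compared. *)
Lemma is_derive_slope (f : R -> R) (x l : R) :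
  is_derive x 1 f l <-> (f r - f x) / (r - x) @[r --> x^'] --> l.
Proof.
have E h : h^-1 *: ((f \o shift x) (h *: (1 : R)) - f x) =
           (f (h + x) - f x) / (h + x - x).
  by rewrite /= addrK mulrC /GRing.scale/= mulr1.
split=> [[df <-]|].
- apply/cvgrPdist_lt => e e0.
  have /cvgrPdist_lt/(_ _ e0)[d /= d0 hd] := df.
  exists d => //= r xr rx; have := hd (r - x); rewrite E subrK; apply => /=.
    by rewrite sub0r normrN distrC.
  by rewrite subr_eq0.
- move=> fl; suff dl : (h^-1 *: ((f \o shift x) (h *: (1 : R)) - f x))
      @[h --> 0^'] --> l.
    by split; [apply/cvg_ex; exists l|exact/cvg_lim].
  apply/cvgrPdist_lt => e e0.
  have /cvgrPdist_lt/(_ _ e0)[d /= d0 hd] := fl.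
  exists d => //= h /=; rewrite sub0r normrN => hd0 h0; rewrite E; apply: hd => /=.
    by rewrite opprD addrCA subrr addr0 normrN.
  by rewrite -subr_eq0 addrK.
Qed.

End Slope.

Section Ramp.
Context {R : realType}.
Implicit Types x y z e : R.

(** The hat function, equal to 1 - |z| on [-1, 1] and to 0 elsewhere, written as a second difference
    of |z|; this gives its antiderivative a closed form. *)
Definition tent z : R := (`|z + 1| - 2 * `|z| + `|z - 1|) / 2.

(* A second difference of [z * `|z|], whose derivative is [2 * `|z|]; this is an
   antiderivative of [tent] that goes from 0 to 1. *)
Definition ramp z : R :=
  ((z + 1) * `|z + 1| - 2 * (z * `|z|) + (z - 1) * `|z - 1| + 2) / 4.

Lemma tent_ge0 z : 0 <= tent z.
Proof.
rewrite /tent; case: (ger0P (z + 1)); case: (ger0P z); case: (ger0P (z - 1));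
  lra.
Qed.

Lemma tent_le1 z : tent z <= 1.
Proof.
rewrite /tent; case: (ger0P (z + 1)); case: (ger0P z); case: (ger0P (z - 1));
  lra.
Qed.

Lemma tent_eq0 z : 1 <= `|z| -> tent z = 0.
Proof.
rewrite /tent; case: (ger0P (z + 1)); case: (ger0P z); case: (ger0P (z - 1));
  lra.
Qed.

Lemma ramp_eq0 z : z <= -1 -> ramp z = 0.
Proof.
by rewrite /ramp; case: (ger0P (z + 1)); case: (ger0P z); case: (ger0P (z - 1));
  move=> *; nra.
Qed.

Lemma ramp_eq1 z : 1 <= z -> ramp z = 1.
Proof.
by rewrite /ramp; case: (ger0P (z + 1)); case: (ger0P z); case: (ger0P (z - 1));
  move=> *; nra.
Qed.

Lemma ramp_itv z : 0 <= ramp z <= 1.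
Proof.
by rewrite /ramp; case: (ger0P (z + 1)); case: (ger0P z); case: (ger0P (z - 1));
  move=> *; apply/andP; split; nra.
Qed.

Lemma continuous_tent : continuous tent.
Proof.
move=> z; apply: cvgM; last exact: cvg_cst.
apply: cvgD.
  apply: cvgB; first by apply: cvg_norm; apply: cvgD; [exact: cvg_id|exact: cvg_cst].
  by apply: cvgM; [exact: cvg_cst|apply: cvg_norm; exact: cvg_id].
by apply: cvg_norm; apply: cvgB; [exact: cvg_id|exact: cvg_cst].
Qed.

(** Near a nonzero z the function is y^2 or -y^2; at 0 its difference quotient is |y|, which tends
    to 0. *)
Lemma is_derive_mul_norm z : is_derive z 1 (fun y => y * `|y|) (2 * `|z|).
Proof.
have sqd : is_derive z 1 (fun y : R => y * y) (z * 1 + z * 1).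
  exact: is_deriveM.
have [z0|z0|->] := ltgtP z 0.
- have -> : 2 * `|z| = - (z * 1 + z * 1) by rewrite ltr0_norm//; ring.
  apply: near_eq_is_derive (is_deriveN sqd).
  near=> y; rewrite /= ltr0_norm ?mulrN//.
  by near: y; exact: lt_nbhsl.
- have -> : 2 * `|z| = z * 1 + z * 1 by rewrite gtr0_norm//; ring.
  apply: near_eq_is_derive sqd.
  near=> y; rewrite /= gtr0_norm//.
  by near: y; exact: lt_nbhsr.
- rewrite normr0 mulr0; apply/is_derive_slope.
  apply: (@cvg_trans _ (`|y| @[y --> 0^'])).
    apply: near_eq_cvg; near=> y; rewrite mul0r !subr0 mulrAC mulfV ?mul1r//.
    by near: y; exact: nbhs_dnbhs_neq.
  apply: cvg_within_filter.
  by have := @norm_continuous R R 0; rewrite /continuous_at normr0.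
Unshelve. all: by end_near. Qed.

Lemma is_derive_ramp z : is_derive z 1 ramp (tent z).
Proof.
have dsq a : is_derive z 1 (fun y => (y + a) * `|y + a|) (2 * `|z + a|).
  rewrite -[2 * _]mulr1.
  apply: (is_derive1_comp (f := fun y => y * `|y|) (g := fun y => y + a)).
    exact: is_derive_mul_norm.
  by rewrite -[1 in X in is_derive _ _ _ X]addr0; exact: is_deriveD.
pose s a : R -> R := fun y => (y + a) * `|y + a|.
have -> : ramp = (s 1 - 2 *: s 0 + s (-1) + cst 2) * cst 4^-1.
  apply/funext => y; rewrite /ramp /s !fctE addr0; congr (_ / _).
have := is_deriveM (is_deriveD (is_deriveD (is_deriveB (dsq 1)
  (is_deriveZ 2 (dsq 0))) (dsq (-1))) (is_derive_cst (2 : R) z 1))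
  (is_derive_cst (4^-1 : R) z 1).
move=> H; apply: (is_derive_eq H).
rewrite /tent /GRing.scale/= !addr0 mulr0 add0r; by field.
Qed.

End Ramp.

(** * Integrals of functions vanishing outside a set *)

Section Support.
Context d (T : measurableType d) {R : realType} {mu : {measure set T -> \bar R}}.
Implicit Types (D : set T) (f h : T -> R).

Lemma integrable_mul_bounded D f h (M : R) : measurable D ->
  mu.-integrable D (EFin \o f) -> measurable_fun D h ->
  (forall z, D z -> `|h z| <= M) ->
  mu.-integrable D (EFin \o (fun z => f z * h z)).
Proof.
move=> mD fi mh hM.
have bh : [bounded h z | z in D].
  exists M; split; first exact: num_real.
  by move=> N MN z Dz; exact: le_trans (hM z Dz) (ltW MN).
exact: (integrableMl mD fi mh bh).
Qed.

Lemma Rintegral_support D f : (forall z, ~ D z -> f z = 0) ->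
  \int[mu]_z f z = \int[mu]_(z in D) f z.
Proof.
move=> f0; rewrite [RHS]Rintegral_mkcond; congr Rintegral; apply/funext => z.
by rewrite patchE; case: ifPn => //; rewrite notin_setE => /f0.
Qed.

Lemma integrable_support D f : measurable D ->
  (forall z, ~ D z -> f z = 0) ->
  mu.-integrable D (EFin \o f) -> mu.-integrable setT (EFin \o f).
Proof.
move=> mD f0 fi; rewrite (_ : EFin \o f = (EFin \o f) \_ D).
  exact: (integrable_mkcond _ mD).1.
apply/funext => z; rewrite patchE; case: ifPn => //.
by rewrite notin_setE => /f0 /= ->.
Qed.

End Support.

(** * Averages against a hat kernel at Lebesgue points *)

Section Mollification.
Context {R : realType}.
Local Notation mu := (@lebesgue_measure R).
Implicit Types (f g h : R -> R) (x y z e : R).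

(** The hat kernel of half-width e about x; the factor e^-1 gives it mass 1. *)
Definition bump x e z : R := e^-1 * tent ((z - x) / e).

Definition smooth_step x e z : R := ramp ((z - x) / e).

Lemma is_derive_smooth_step x e z :
  is_derive z 1 (smooth_step x e) (bump x e z).
Proof.
rewrite /bump mulrC.
apply: (is_derive1_comp (f := ramp) (g := fun y => (y - x) / e)).
  exact: is_derive_ramp.
have H := is_deriveM (is_deriveB (is_derive_id z 1) (is_derive_cst x z 1))
  (is_derive_cst (e^-1 : R) z 1).
apply: (is_derive_eq H).
by rewrite /GRing.scale/= mulr0 add0r subr0 mulr1.
Qed.

Lemma continuous_bump x e : continuous (bump x e).
Proof.
move=> z; apply: cvgM; first exact: cvg_cst.
apply: (continuous_comp (f := fun y => (y - x) / e)); last exact: continuous_tent.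
by apply: cvgM; [apply: cvgB; [exact: cvg_id|exact: cvg_cst]|exact: cvg_cst].
Qed.

Lemma measurable_bump x e (D : set R) : measurable_fun D (bump x e).
Proof.
apply: measurable_funTS; apply: continuous_measurable_fun.
exact: continuous_bump.
Qed.

Lemma bump_ge0 x e z : 0 < e -> 0 <= bump x e z.
Proof. by move=> e0; rewrite mulr_ge0 ?invr_ge0 ?tent_ge0// ltW. Qed.

Lemma bump_le x e z : 0 < e -> bump x e z <= e^-1.
Proof. by move=> e0; rewrite ler_piMr ?tent_le1// invr_ge0 ltW. Qed.

Lemma normr_bump_le x e z : 0 < e -> `|bump x e z| <= e^-1.
Proof. by move=> e0; rewrite ger0_norm ?bump_ge0 ?bump_le. Qed.

Lemma bump_eq0 x e z : 0 < e -> ~ ball x e z -> bump x e z = 0.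
Proof.
move=> e0; rewrite /ball/= => /negP; rewrite -leNgt => xz.
by rewrite /bump tent_eq0 ?mulr0// normrM normfV (gtr0_norm e0) ler_pdivlMr// mul1r distrC.
Qed.

Lemma ball_subset_itv x e : ball x e `<=` `[x - e, x + e].
Proof. by rewrite ball_itv; exact: subset_itv_oo_cc. Qed.

Lemma Rintegral_bump x e : 0 < e -> \int[mu]_z bump x e z = 1.
Proof.
move=> e0; rewrite (@Rintegral_support _ _ _ mu `[x - e, x + e]); last first.
  by move=> z Dz; apply: bump_eq0 => // /ball_subset_itv.
rewrite /Rintegral (@continuous_FTC2 _ _ (smooth_step x e)).
- rewrite /smooth_step !(addrC x) !addrK mulNr divff ?gt_eqF//.
  by rewrite ramp_eq1// ramp_eq0//= subr0.
- lra.
- by apply: continuous_subspaceT; exact: continuous_bump.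
- have cs z : {for z, continuous (smooth_step x e)}.
    apply: differentiable_continuous; apply/derivable1_diffP.
    by have [] := is_derive_smooth_step x e z.
  split => [z _| |]; first by have [] := is_derive_smooth_step x e z.
    by apply: cvg_at_right_filter; exact: cs.
  by apply: cvg_at_left_filter; exact: cs.
- by move=> z _; rewrite derive1E; have [] := is_derive_smooth_step x e z.
Qed.

Definition locally_integrable_itv f :=
  forall a b : R, mu.-integrable `[a, b] (EFin \o f).

Lemma integrable_mul_bump f x e : locally_integrable_itv f -> 0 < e ->
  mu.-integrable setT (EFin \o (fun z => f z * bump x e z)).
Proof.
move=> fi e0; apply: (@integrable_support _ _ _ mu `[x - e, x + e]) => //.
  move=> z Dz; rewrite bump_eq0 ?mulr0// => /ball_subset_itv; exact: Dz.
apply: (integrable_mul_bounded (M := e^-1)) => //; first exact: measurable_bump.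
by move=> z _; exact: normr_bump_le.
Qed.

(** As the kernel has mass 1, the error is the integral of (f x - f z) against the kernel over the
    ball. The kernel is at most 1 / e, and the ball has length 2 e, whence the factor 2 before the
    mean [davg]. *)
Lemma mollify_dist f x e : locally_integrable_itv f -> 0 < e ->
  (`|f x - \int[mu]_z (f z * bump x e z)|%:E <= 2%:E * davg f x e)%E.
Proof.
move=> fi e0.
have mB : @measurable _ (measurableTypeR R) (ball x e) by exact: measurable_ball.
have muB : (mu (ball x e) < +oo)%E by rewrite lebesgue_measure_ball ?ltW ?ltry.
have fB : mu.-integrable (ball x e) (EFin \o f).
  by apply: integrableS (fi (x - e) (x + e)) => //; exact: ball_subset_itv.
have cB (c : R) : mu.-integrable (ball x e) (EFin \o cst c).
  apply: measurable_bounded_integrable => //.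
  exists `|c|; split; first exact: num_real.
  by move=> N cN z _; exact: ltW.
have dB : mu.-integrable (ball x e) (EFin \o (fun z => f x - f z)).
  exact: (integrableB mB (cB (f x)) fB).
have bB g : mu.-integrable (ball x e) (EFin \o g) ->
    mu.-integrable (ball x e) (EFin \o (fun z => g z * bump x e z)).
  move=> gi; apply: (integrable_mul_bounded (M := e^-1)) => //.
    exact: measurable_bump.
  by move=> z _; exact: normr_bump_le.
have supp g : \int[mu]_z (g z * bump x e z) =
    \int[mu]_(z in ball x e) (g z * bump x e z).
  by apply: Rintegral_support => z Bz; rewrite bump_eq0 ?mulr0.
have -> : f x - \int[mu]_z (f z * bump x e z) =
    \int[mu]_(z in ball x e) ((f x - f z) * bump x e z).
  rewrite -[f x in LHS]mulr1 -(Rintegral_bump x e0) -RintegralZl//; last first.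
    have := @integrable_mul_bump (cst 1) x e _ e0; under eq_fun do rewrite mul1r.
    apply => a b; apply: continuous_compact_integrable; first exact: segment_compact.
    by move=> ?; exact: cst_continuous.
  rewrite (supp (cst (f x))) supp -RintegralB//; last 2 first.
  - exact: bB.
  - exact: bB.
  by apply: eq_Rintegral => z _; rewrite mulrBl.
rewrite EFin_normr_Rintegral//; last exact: bB.
apply: (@le_trans _ _ (\int[mu]_(z in ball x e) (e^-1%:E * `|(f z - f x)%:E|))%E).
  apply: (le_trans (le_abse_integral _ _ _)) => //.
    by have /measurable_int := bB _ dB.
  apply: ge0_le_integral => //.
  - by apply: measurableT_comp => //; have /measurable_int := bB _ dB.
  - apply: emeasurable_funM => //; apply: measurableT_comp => //.
    by have /measurable_int := integrableB mB fB (cB (f x)).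
  - move=> z _; rewrite /= lee_fin normrM mulrC distrC ler_wpM2r//.
    exact: normr_bump_le.
rewrite ge0_integralZl//; last 2 first.
- apply: measurableT_comp => //.
  by have /measurable_int := integrableB mB fB (cB (f x)).
- by rewrite lee_fin invr_ge0 ltW.
rewrite /davg /iavg lebesgue_measure_ball ?(ltW e0)// inver mulrn_eq0/= gt_eqF//.
rewrite muleA -EFinM (_ : 2 * (e *+ 2)^-1 = e^-1); last first.
  by rewrite -(mulr_natr e) invfM mulrCA mulfV ?mulr1.
by [].
Qed.

Lemma mollify_cvg f x : locally_integrable_itv f -> lebesgue_pt f x ->
  \int[mu]_z (f z * bump x e z) @[e --> 0^'+] --> f x.
Proof.
move=> fi fx; apply/cvgrPdist_lt => r r0.
have [fin /cvgrPdist_lt] := (fine_cvgP _ _).1 fx.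
have r20 : 0 < r / 2 by rewrite divr_gt0.
move=> /(_ _ r20) cv.
near=> e.
have e0 : 0 < e by near: e; exact: nbhs_right_gt.
have fe : davg f x e \is a fin_num by near: e.
have : `|0 - fine (davg f x e)| < r / 2 by near: e.
rewrite sub0r normrN ger0_norm ?fine_ge0 ?davg_ge0// => de.
have := @mollify_dist f x e fi e0; rewrite -(fineK fe) -EFinM lee_fin.
move/le_lt_trans; apply; lra.
Unshelve. all: by end_near. Qed.

End Mollification.

(** * Weak derivatives and Lebesgue points *)

Section WeakFTC.
Context {R : realType}.
Local Notation mu := (@lebesgue_measure R).
Local Notation L2 := (Lfun mu 2%:E).
Implicit Types (f g h : R -> R) (x y z e : R).

Lemma Lfun2_measurable f : f \in L2 -> measurable_fun setT f.
Proof. by rewrite inE => /andP[/[!inE]]. Qed.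

(** On a bounded interval 1 + f^2 is integrable, and it dominates |f|. *)
Lemma Lfun2_integrable_itv f : f \in L2 -> locally_integrable_itv f.
Proof.
move=> f2 a b; have mf := Lfun2_measurable f2.
have i1 : mu.-integrable `[a, b] (EFin \o cst (1 : R)).
  apply: continuous_compact_integrable; first exact: segment_compact.
  by move=> ?; exact: cst_continuous.
have i2 : mu.-integrable `[a, b] (EFin \o (fun z => f z ^+ 2)).
  exact: (integrableS _ _ _ (Lfun2_integrable_sqr f2)).
have := integrableD _ i1 i2; move=> /(_ (measurable_itv _)).
apply: le_integrable => //.
  by apply/measurable_EFinP; exact: measurable_funTS.
move=> z _ /=; rewrite lee_fin [leRHS]ger0_norm; last first.
  by rewrite addr_ge0// sqr_ge0.
rewrite -real_normK ?num_real//; have := normr_ge0 (f z); nra.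
Qed.

Lemma locally_integrable_itvP f : measurable_fun setT f ->
  locally_integrable_itv f -> locally_integrable setT f.
Proof.
move=> mf fi; split => //; first exact: openT.
move=> K _ cK.
have [M [_ KM]] := compact_bounded cK.
pose N := `|M| + 1.
have KN : K `<=` `[- N, N].
  move=> z Kz; have := KM N _ z Kz; rewrite /= in_itv/= -ler_norml; apply.
  by rewrite /N (le_lt_trans (ler_norm M))// ltrDl.
have /integrableP[_] := fi (- N) N; apply: le_lt_trans.
apply: ge0_subset_integral => //; first exact: compact_measurable.
by apply/measurable_EFinP/measurableT_comp => //; exact: measurable_funTS.
Qed.

Lemma Lfun2_ae_lebesgue_pt f : f \in L2 -> {ae mu, forall x, lebesgue_pt f x}.
Proof.
move=> f2; apply: lebesgue_differentiation; apply: locally_integrable_itvP.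
  exact: Lfun2_measurable.
exact: Lfun2_integrable_itv.
Qed.

(** The function on which weak derivatives are tested: as e tends to 0 it approaches the indicator
    of [x, y], while its derivative is a difference of two kernels of mass 1. *)
Definition plateau x y e z : R := smooth_step x e z - smooth_step y e z.

Lemma is_derive_plateau x y e z :
  is_derive z 1 (plateau x y e) (bump x e z - bump y e z).
Proof. by apply: is_deriveB; exact: is_derive_smooth_step. Qed.

Lemma derive1_plateau x y e :
  derive1 (plateau x y e) = fun z => bump x e z - bump y e z.
Proof.
by apply/funext => z; rewrite derive1E; have [] := is_derive_plateau x y e z.
Qed.

Lemma smooth_step_eq0 x e z : 0 < e -> z <= x - e -> smooth_step x e z = 0.
Proof. by move=> e0 zx; rewrite /smooth_step ramp_eq0// ler_pdivrMr//; lra. Qed.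

Lemma smooth_step_eq1 x e z : 0 < e -> x + e <= z -> smooth_step x e z = 1.
Proof. by move=> e0 zx; rewrite /smooth_step ramp_eq1// ler_pdivlMr//; lra. Qed.

Lemma plateau_eq0 x y e z : 0 < e -> x < y -> ~ `[x - e, y + e]%classic z ->
  plateau x y e z = 0.
Proof.
move=> e0 xy; rewrite /= in_itv/= => /negP; rewrite negb_and -!ltNge.
rewrite /plateau => /orP[zx|yz].
  by rewrite !smooth_step_eq0 ?subrr//; lra.
by rewrite !smooth_step_eq1 ?subrr//; lra.
Qed.

Lemma normr_plateau_le x y e z : `|plateau x y e z| <= 1.
Proof.
rewrite /plateau /smooth_step.
have /andP[? ?] := ramp_itv ((z - x) / e).
have /andP[? ?] := ramp_itv ((z - y) / e).
by rewrite ler_norml; apply/andP; split; lra.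
Qed.

Lemma test_function_plateau x y e : 0 < e -> x < y ->
  test_function (plateau x y e).
Proof.
move=> e0 xy; split.
- by move=> z; have [] := is_derive_plateau x y e z.
- rewrite derive1_plateau => z; apply: cvgB; exact: continuous_bump.
- apply: (@subclosed_compact _ _ `[x - e, y + e]).
  + exact: closed_closure.
  + exact: segment_compact.
  + rewrite closureE; apply: smallest_sub; first exact: itv_closed.
    move=> z /= z0; apply: contrapT => Dz; move/eqP: z0; apply.
    exact: plateau_eq0.
Qed.

Lemma plateau_indic x y e z : x < y -> 0 < e -> e < `|z - x| -> e < `|z - y| ->
  plateau x y e z = \1_`[x, y] z.
Proof.
move=> xy e0; rewrite indicE /plateau.
have [zltx|xltz|->] := ltgtP z x; last by rewrite subrr normr0 ltNge ltW.
  rewrite memNset /=; last by rewrite in_itv/= leNgt zltx.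
  rewrite !ltr0_norm ?subr_lt0//; last exact: lt_trans xy.
  by move=> ? ?; rewrite !smooth_step_eq0 ?subrr//; lra.
have [zlty|yltz|->] := ltgtP z y; last by rewrite subrr normr0 [e < 0]ltNge ltW.
  rewrite mem_set /=; last by rewrite in_itv/= !ltW.
  rewrite gtr0_norm 1?ltr0_norm ?subr_gt0 ?subr_lt0// => ? ?.
  by rewrite smooth_step_eq1 1?smooth_step_eq0 ?subr0//; lra.
rewrite memNset /=; last by rewrite in_itv/= [z <= y]leNgt yltz andbF.
rewrite !gtr0_norm ?subr_gt0// => ? ?.
by rewrite !smooth_step_eq1 ?subrr//; lra.
Qed.

(** The sequence is constant once 1 / (n + 1) is below the distances from z to x and to y. *)
Lemma plateau_cvg x y z : x < y -> z != x -> z != y ->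
  plateau x y n.+1%:R^-1 z @[n --> \oo] --> (\1_`[x, y] z : R).
Proof.
move=> xy zx zy; pose d := Num.min `|z - x| `|z - y|.
have d0 : 0 < d by rewrite lt_min !normr_gt0 !subr_eq0 zx.
apply: cvg_near_cst; near=> n.
have : n.+1%:R^-1 < d by near: n; exact: near_infty_natSinv_lt (PosNum d0).
by rewrite lt_min => /andP[nx ny]; apply: plateau_indic; rewrite ?invr_gt0.
Unshelve. all: by end_near. Qed.

(** Dominated convergence concerns sequences, so the width e is taken along 1 / (n + 1). *)
Lemma natSinv_cvg_at_right : (n.+1%:R^-1 : R) @[n --> \oo] --> (0 : R)^'+.
Proof.
move=> P [d /= d0 dP].
suff : \forall n \near \oo, P n.+1%:R^-1 by [].
near=> n; apply: dP => /=; last by rewrite invr_gt0.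
rewrite sub0r normrN gtr0_norm ?invr_gt0//.
by near: n; exact: near_infty_natSinv_lt (PosNum d0).
Unshelve. all: by end_near. Qed.

Lemma plateau_integral_cvg g x y : measurable_fun setT g ->
  locally_integrable_itv g -> x < y ->
  \int[mu]_z (g z * plateau x y n.+1%:R^-1 z) @[n --> \oo] -->
  \int[mu]_(z in `[x, y]) g z.
Proof.
move=> mg gi xy.
pose F (n : nat) z := (g z * plateau x y n.+1%:R^-1 z)%:E.
pose G z := (g z * \1_`[x, y] z)%:E.
(* The widths are at most 1, so every plateau vanishes outside [x - 1, y + 1], and |g| on that
   interval dominates. *)
pose H := (EFin \o (fun z => `|g z|)) \_ `[x - 1, y + 1].
have mp n : measurable_fun setT (plateau x y n.+1%:R^-1).
  apply: continuous_measurable_fun => z.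
  apply: differentiable_continuous; apply/derivable1_diffP.
  by have [] := is_derive_plateau x y n.+1%:R^-1 z.
have mF n : measurable_fun setT (F n).
  by apply/measurable_EFinP; exact: measurable_funM.
have mG : measurable_fun setT G.
  by apply/measurable_EFinP; apply: measurable_funM => //; exact: measurable_indic.
(* At x and y the plateaus tend to 1/2 instead of 1; these two points form a null set. *)
have FG : {ae mu, forall z, setT z -> F ^~ z @ \oo --> G z}.
  have N (a : R) : {ae mu, forall z, z != a}.
    exists [set a]; split => //; first exact: lebesgue_measure_set1.
    by move=> z /= /negP; rewrite negbK => /eqP.
  apply: filterS2 (N x) (N y); first exact: (ae_filter_ringOfSetsType mu).
  move=> z zx zy _.
  apply: cvg_EFin; first exact: nearW.
  by apply: cvgM; [exact: cvg_cst|exact: plateau_cvg].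
have Hi : mu.-integrable setT H.
  apply/(integrable_mkcond _ _).1 => //.
  exact: (integrable_norm (gi _ _)).
have FH : {ae mu, forall z n, setT z -> (`|F n z| <= H z)%E}.
  apply: aeW => z n _; rewrite /H patchE; case: ifPn => /= zxy.
    by rewrite lee_fin normrM ler_piMr// normr_plateau_le.
  rewrite /F plateau_eq0// ?invr_gt0// ?mulr0 ?normr0//.
  move: zxy; rewrite notin_setE; apply: contra_not => /=; rewrite !in_itv/=.
  have : (n.+1%:R^-1 : R) <= 1 by rewrite invf_le1// ler1n.
  by move: _^-1 => e ? /andP[? ?]; apply/andP; split; lra.
have [Gi _ cF] := @dominated_convergence _ _ _ mu setT measurableT F G H mF mG FG Hi FH.
have -> : \int[mu]_(z in `[x, y]) g z = fine (\int[mu]_z G z).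
  rewrite Rintegral_mkcond /Rintegral; congr fine; apply: eq_integral => z _.
  by rewrite patchE /G indicE; case: (_ \in _); rewrite ?mulr1 ?mulr0.
apply: fine_cvg; rewrite fineK//.
by apply: integrable_fin_num.
Qed.

(** Tested on [plateau], the weak derivative equates an integral of g against an approximate
    indicator with the mean of f around y minus that around x. Both sides converge, the means
    because x and y are Lebesgue points. *)
Lemma weak_derivative_FTC f g x y : f \in L2 -> g \in L2 ->
  weak_derivative f g -> lebesgue_pt f x -> lebesgue_pt f y -> x < y ->
  f y - f x = \int[mu]_(z in `[x, y]) g z.
Proof.
move=> f2 g2 fg fx fy xy.
have fi := Lfun2_integrable_itv f2.
have E n : \int[mu]_z (g z * plateau x y n.+1%:R^-1 z) =
    \int[mu]_z (f z * bump y n.+1%:R^-1 z) -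
    \int[mu]_z (f z * bump x n.+1%:R^-1 z).
  have n0 : (0 : R) < n.+1%:R^-1 by rewrite invr_gt0.
  have := fg _ (test_function_plateau n0 xy); rewrite derive1_plateau.
  move=> /(congr1 -%R); rewrite opprK => <-; rewrite -opprB; congr (- _).
  rewrite -RintegralB//; [|exact: integrable_mul_bump..].
  by apply: eq_Rintegral => z _; rewrite mulrBr.
have := plateau_integral_cvg (Lfun2_measurable g2) (Lfun2_integrable_itv g2) xy.
under eq_fun do rewrite E.
have cv w : lebesgue_pt f w ->
    \int[mu]_z (f z * bump w n.+1%:R^-1 z) @[n --> \oo] --> f w.
  by move=> fw; exact: (cvg_comp _ _ natSinv_cvg_at_right (mollify_cvg fi fw)).
have cf : \int[mu]_z (f z * bump y n.+1%:R^-1 z) -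
    \int[mu]_z (f z * bump x n.+1%:R^-1 z) @[n --> \oo] --> f y - f x.
  by apply: cvgB; exact: cv.
by move=> cg; exact: (cvg_unique (@Rhausdorff R) cf cg).
Qed.

End WeakFTC.

(** * Pointwise bound by the H^1 norm *)

Section Sobolev.
Context {R : realType}.
Local Notation mu := (@lebesgue_measure R).
Local Notation L2 := (Lfun mu 2%:E).
Local Notation "'N2[ f ]" := ('N[mu]_2%:E[EFin \o f])%E (f at level 0).
Implicit Types (f g h phi : R -> R) (x y z : R).

(** Hölder's inequality against the indicator of an interval of length 1, whose L^2 norm is 1. *)
Lemma unit_itv_Lnorm_le f x : f \in L2 ->
  ((\int[mu]_(z in `[x, (x + 1)%R]) `|f z|%:E) <= 'N2[f])%E.
Proof.
move=> f2; have mf := Lfun2_measurable f2.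
have m1 : measurable_fun setT (\1_`[x, x + 1] : R -> R).
  exact: measurable_indic.
have two0 : (0 : R) < 2 by [].
have conj2 : (2^-1 + 2^-1 = 1 :> R) by rewrite [RHS]splitr !div1r.
have := hoelder mu mf m1 two0 two0 conj2.
have -> : ('N2[\1_`[x, (x + 1)%R]] = 1)%E.
  rewrite unlock /Lnorm.
  rewrite (eq_integral (fun z : measurableTypeR R => (\1_`[x, x + 1] z)%:E)); last first.
    move=> z _ /=; congr EFin.
    rewrite indicE; case: (_ \in _); rewrite ?normr1 ?powR1//.
    by rewrite normr0 powR0.
  have mu1 : mu `[x, x + 1] = 1%E.
    rewrite lebesgue_measure_itv/= lte_fin ltrDl ltr01 -EFinD.
    by rewrite addrAC subrr add0r.
  by rewrite integral_indic// setIT [X in (X `^ _)%E]mu1 poweR1r.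
rewrite mule1 Lnorm1; apply: le_trans.
rewrite [leLHS]integral_mkcond le_eqVlt; apply/orP; left; apply/eqP.
congr (integral _ _ _); apply/funext => z.
by rewrite patchE /= indicE; case: (_ \in _); rewrite ?mulr1 ?mulr0 ?normr0.
Qed.

(** A null set cannot contain an interval of positive length. *)
Lemma ae_exists_itv (P : R -> Prop) (a b : R) : a < b -> {ae mu, forall z, P z} ->
  exists2 z, a < z < b & P z.
Proof.
move=> ab [N [mN N0 PN]]; apply: contrapT => nP.
have abN : `]a, b[ `<=` N.
  move=> z; rewrite /= in_itv/= => zab; apply: PN => Pz; apply: nP.
  by exists z.
have : (mu `]a, b[ <= mu N)%E by apply: le_measure; rewrite ?inE//.
rewrite N0 lebesgue_measure_itv/= lte_fin ab -EFinD lee_fin leNgt.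
by rewrite subr_gt0 ab.
Qed.

(** For almost every y in D = [x, x + 1], |f x| is at most |f y| plus the integral of |g| over D.
    Integrating in y over D, which has measure 1, leaves two integrals over D, each bounded by an
    L^2 norm. *)
Lemma sobolev_pointwise_bound f g x : f \in L2 -> g \in L2 ->
  weak_derivative f g -> lebesgue_pt f x ->
  (`|f x|%:E <= 'N2[f] + 'N2[g])%E.
Proof.
move=> f2 g2 fg fx.
pose D := `[x, x + 1]%classic.
have mD : @measurable _ (measurableTypeR R) D by exact: measurable_itv.
have fi := Lfun2_integrable_itv f2 x (x + 1).
have gi := Lfun2_integrable_itv g2 x (x + 1).
pose B := \int[mu]_(z in D) `|g z|.
have gB : B%:E = (\int[mu]_(z in D) `|g z|%:E)%E.
  by rewrite fineK//; apply: integrable_fin_num => //; exact: integrable_norm.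
have H : {ae mu, forall y, D y -> (`|f x|%:E <= `|f y|%:E + B%:E)%E}.
  have := Lfun2_ae_lebesgue_pt f2.
  apply: filterS; first exact: (ae_filter_ringOfSetsType mu).
  move=> y fy; rewrite /D/= in_itv/= => /andP[]; rewrite le_eqVlt.
  rewrite -EFinD lee_fin => /predU1P[<- _|xy yx1].
    by rewrite lerDl Rintegral_ge0.
  have -> : f x = f y - \int[mu]_(z in `[x, y]) g z.
    by rewrite -(weak_derivative_FTC f2 g2 fg fx fy xy) subKr.
  apply: (le_trans (ler_normB _ _)); rewrite lerD2l.
  have sub : `[x, y] `<=` D by apply: subset_itvl; rewrite bnd_simp.
  apply: (le_trans (le_normr_Rintegral _ _)) => //.
    exact: integrableS gi.
  rewrite -lee_fin gB fineK; last first.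
    apply: integrable_fin_num => //; apply: integrable_norm.
    exact: integrableS gi.
  apply: ge0_subset_integral => //.
  by have /measurable_int := integrable_norm gi.
have mfD : measurable_fun D (fun y => `|f y|%:E).
  by have /measurable_int := integrable_norm fi.
have B0 : 0 <= B by exact: Rintegral_ge0.
have muD : mu D = 1%E.
  rewrite lebesgue_measure_itv/= lte_fin ltrDl ltr01 -EFinD.
  by rewrite addrAC subrr add0r.
have : (\int[mu]_(y in D) `|f x|%:E <= \int[mu]_(y in D) (`|f y|%:E + B%:E))%E.
  apply: ae_ge0_le_integral => //.
  - by move=> y _; rewrite adde_ge0 ?lee_fin.
  - exact: emeasurable_funD.
have int1 (c : R) : (\int[mu]_(y in D) c%:E = c%:E)%E.
  by rewrite integral_cst// [X in (_ * X)%E]muD mule1.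
have -> : (\int[mu]_(y in D) (`|f y|%:E + B%:E) =
    \int[mu]_(y in D) `|f y|%:E + B%:E)%E.
  by rewrite ge0_integralD// int1.
rewrite int1 => /le_trans; apply; apply: leeD.
  exact: unit_itv_Lnorm_le.
by rewrite gB; exact: unit_itv_Lnorm_le.
Qed.

End Sobolev.

(** * Linearity of weak derivatives and classical differentiability in H^2 *)

Section WeakDerivative.
Context {R : realType}.
Local Notation mu := (@lebesgue_measure R).
Local Notation L2 := (Lfun mu 2%:E).
Implicit Types (f g h phi : R -> R) (x y z a b : R).

Lemma continuous_bounded_itv phi a b : continuous phi ->
  exists M, forall z, `[a, b]%classic z -> `|phi z| <= M.
Proof.
move=> cphi.
have [M [_ HM]] : bounded_set (phi @` `[a, b]).
  apply: compact_bounded; apply: continuous_compact; last exact: segment_compact.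
  exact: continuous_subspaceT.
exists (M + 1) => z abz; apply: (HM (M + 1)); first by rewrite ltrDl.
by exists z.
Qed.

(** The complement of the closed support is open, so phi vanishes near each of its points and its
    derivative vanishes there too. *)
Lemma test_function_support phi : test_function phi ->
  exists N, forall z, ~ `[- N, N]%classic z -> phi z = 0 /\ derive1 phi z = 0.
Proof.
move=> [_ _ cK]; set K := closure _ in cK.
have [M [_ KM]] := compact_bounded cK.
exists (`|M| + 1) => z zN.
have nKz : ~ K z.
  move=> Kz; apply: zN; rewrite /= in_itv/= -ler_norml; apply: KM Kz.
  by rewrite (le_lt_trans (ler_norm M))// ltrDl.
have out y : ~ K y -> phi y = 0.
  by apply: contra_notP => y0; apply: subset_closure; exact/eqP.
split; first exact: out.
rewrite derive1E; transitivity ('D_1 (cst (0 : R)) z); last exact: derive_cst.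
apply: near_eq_derive.
have oK : open (~` K) by apply: closed_openC; exact: closed_closure.
by apply: filterS (open_nbhs_nbhs (conj oK nKz)) => y /out.
Qed.

(** Linearity of the integral, and through it linearity of the weak derivative, asks for the
    integrability of these products. *)
Lemma Lfun2_integrable_test f phi : f \in L2 -> test_function phi ->
  mu.-integrable setT (EFin \o (fun z => f z * phi z)) /\
  mu.-integrable setT (EFin \o (fun z => f z * derive1 phi z)).
Proof.
move=> f2 tphi; have [N supp] := test_function_support tphi.
have int psi : continuous psi -> (forall z, ~ `[- N, N]%classic z -> psi z = 0) ->
    mu.-integrable setT (EFin \o (fun z => f z * psi z)).
  move=> cpsi psi0; have [M psiM] := continuous_bounded_itv (- N) N cpsi.
  apply: (@integrable_support _ _ _ mu `[- N, N]) => //.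
    by move=> z zN; rewrite psi0 ?mulr0.
  apply: (integrable_mul_bounded (M := M)) => //.
  - exact: Lfun2_integrable_itv.
  - by apply: measurable_funTS; exact: continuous_measurable_fun.
have [dphi cdphi _] := tphi.
split; apply: int => //; [|by move=> z /supp[]|by move=> z /supp[]].
by move=> z; exact/differentiable_continuous/derivable1_diffP.
Qed.

Lemma weak_derivative_comb f1 g1 f2 g2 a b :
  f1 \in L2 -> g1 \in L2 -> f2 \in L2 -> g2 \in L2 ->
  weak_derivative f1 g1 -> weak_derivative f2 g2 ->
  weak_derivative (a *: f1 + b *: f2) (a *: g1 + b *: g2).
Proof.
move=> f12 g12 f22 g22 fg1 fg2 phi tphi.
have [_ if1] := Lfun2_integrable_test f12 tphi.
have [_ if2] := Lfun2_integrable_test f22 tphi.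
have [ig1 _] := Lfun2_integrable_test g12 tphi.
have [ig2 _] := Lfun2_integrable_test g22 tphi.
have comb u1 u2 psi :
    mu.-integrable setT (EFin \o (fun z => u1 z * psi z)) ->
    mu.-integrable setT (EFin \o (fun z => u2 z * psi z)) ->
    \int[mu]_z ((a *: u1 + b *: u2) z * psi z) =
    a * \int[mu]_z (u1 z * psi z) + b * \int[mu]_z (u2 z * psi z).
  move=> i1 i2; rewrite -RintegralZl// -RintegralZl// -RintegralD//.
  - by apply: eq_Rintegral => z _; rewrite !fctE /GRing.scale/= mulrDl !mulrA.
  - exact: (integrableZl measurableT a i1).
  - exact: (integrableZl measurableT b i2).
by rewrite !comb// (fg1 _ tphi) (fg2 _ tphi) !mulrN opprD.
Qed.

(** This is membership in H^1, the regularity at which the pointwise bound applies. *)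
Definition weakly_differentiable f :=
  f \in L2 /\ exists2 g, g \in L2 & weak_derivative f g.

Lemma sobolev_Lfun2 k f : sobolev k f -> f \in L2.
Proof. by case: k => [//|k] []. Qed.

Lemma sobolevS_weakly_differentiable k f :
  sobolev k.+1 f -> weakly_differentiable f.
Proof.
by move=> [f2 [g fg /sobolev_Lfun2 g2]]; split => //; exists g.
Qed.

Lemma Lfun2_comb f g a b : f \in L2 -> g \in L2 -> a *: f + b *: g \in L2.
Proof.
have p1 : (1 <= 2%:E :> \bar R)%E by rewrite lee_fin ler1n.
have [zero2 lin] := Lfun_submod_closed mu p1.
by move=> f2 g2; apply: (lin) => //; rewrite -[b *: g]addr0; exact: lin.
Qed.

Lemma weakly_differentiable_comb f1 f2 a b :
  weakly_differentiable f1 -> weakly_differentiable f2 ->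
  weakly_differentiable (a *: f1 + b *: f2).
Proof.
move=> [f12 [g1 g12 fg1]] [f22 [g2 g22 fg2]].
split; first exact: Lfun2_comb.
by exists (a *: g1 + b *: g2); [exact: Lfun2_comb|exact: weak_derivative_comb].
Qed.

(** A weak derivative in L^2 exists, so the choice in [wderiv] does not fall back on its default
    0. *)
Lemma wderivP f : weakly_differentiable f ->
  wderiv f \in L2 /\ weak_derivative f (wderiv f).
Proof.
move=> [_ [g g2 fg]].
have ex : exists g, [set g | g \in L2 /\ weak_derivative f g] g by exists g.
exact: (xgetPex (cst 0) ex).
Qed.

(** The weak derivative g agrees almost everywhere on [A, x + 1] with the continuous primitive K of
    its own weak derivative h. Hence f z is f A plus the integral of K from A to z for z near x, and
    the fundamental theorem of calculus differentiates this at x. *)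
Lemma sobolevSS_derivable k f x : continuous f -> sobolev k.+2 f ->
  derivable f x 1.
Proof.
move=> cf [f2 [g fg [g2 [h gh /sobolev_Lfun2 h2]]]].
have ptf z : lebesgue_pt f z.
  apply: (@continuous_lebesgue_pt _ _ _ setT) => //; last exact: cf.
    by split; [exact: openT|].
  exact: Lfun2_measurable.
have aeg := Lfun2_ae_lebesgue_pt g2.
have x1x : x - 1 < x by rewrite ltrBlDr ltrDl.
(* The base point must be a Lebesgue point of g, so that g t - g A is the integral of h from A to t
   for almost every t. *)
have [A /andP[_ Ax] gA] := ae_exists_itv x1x aeg.
have xx1 : x < x + 1 by rewrite ltrDl.
have Ax1 : A < x + 1 by exact: lt_trans xx1.
have hi := Lfun2_integrable_itv h2.
pose K z := g A + \int[mu]_(t in `[A, z]) h t.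
have cK : {within `[A, x + 1], continuous K}.
  move=> z; apply: cvgD; first exact: cvg_cst.
  by apply: parameterized_integral_continuous; [exact: ltW|exact: hi].
have iK : mu.-integrable `[A, x + 1] (EFin \o K).
  by apply: continuous_compact_integrable; first exact: segment_compact.
have cKx : {for x, continuous K}.
  apply: (within_continuous_continuous Ax1 cK).
  by rewrite in_itv/= Ax.
have gK z : z \in `]A, x + 1[ -> \int[mu]_(t in `[A, z]) g t = \int[mu]_(t in `[A, z]) K t.
  rewrite in_itv/= => /andP[Az zx1].
  have sub : `[A, z] `<=` `[A, x + 1] by apply: subset_itvl; rewrite bnd_simp ltW.
  congr fine; apply: ae_eq_integral => //.
  - by have /measurable_int := Lfun2_integrable_itv g2 A z.
  - apply: (measurable_funS _ sub) => //.
    by have /measurable_int := iK.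
  move: aeg; apply: filterS; first exact: (ae_filter_ringOfSetsType mu).
  move=> t gt; rewrite /= in_itv/= => /andP[At tz]; congr EFin.
  rewrite /K; move: At; rewrite le_eqVlt => /predU1P[<-|At].
    by rewrite set_itv1 Rintegral_set1 addr0.
  by rewrite -(weak_derivative_FTC g2 h2 gh gA gt At) addrC subrK.
have [dK _] := continuous_FTC1_closed xx1 iK Ax cKx.
apply: near_eq_derivable (derivableD (derivable_cst (f A) x 1) dK).
near=> z.
have zI : z \in `]A, x + 1[.
  by rewrite in_itv/=; apply/andP; split; near: z; [exact: lt_nbhsr|exact: lt_nbhsl].
rewrite fctE -gK// -(weak_derivative_FTC f2 g2 fg (ptf A) (ptf z)); last first.
  by move: zI; rewrite in_itv/= => /andP[].
by rewrite addrC subrK.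
Unshelve. all: by end_near. Qed.

End WeakDerivative.

(** * Time derivatives *)

Section TimeDerivative.
Context {R : realType}.
Local Notation mu := (@lebesgue_measure R).
Local Notation L2 := (Lfun mu 2%:E).
Local Notation "'N2[ f ]" := ('N[mu]_2%:E[EFin \o f%R])%E (f at level 0).

(** Points of [0, T] other than t lie arbitrarily close to t: on its right if t < T, on its left if
    t = T. This makes limits of time quotients unique. *)
Lemma within_itv_dnbhs_proper (T t : R) : 0 < T -> t \in `[0, T] ->
  ProperFilter (within `[0, T] t^').
Proof.
move=> T0; rewrite in_itv/= => /andP[t0 tT].
split; last exact: within_filter.
move=> [d /= d0 hd].
have d20 : 0 < d / 2 by rewrite divr_gt0.
have [tltT|] := ltP t T.
  have m0 : 0 < Num.min (d / 2) (T - t) by rewrite lt_min d20 subr_gt0.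
  have md : Num.min (d / 2) (T - t) <= d / 2 by rewrite ge_min lexx.
  have mT : Num.min (d / 2) (T - t) <= T - t by rewrite ge_min lexx orbT.
  move: m0 md mT; set m := Num.min _ _ => m0 md mT.
  apply: (hd (t + m)) => /=.
  - by rewrite opprD addNKr normrN gtr0_norm//; lra.
  - by rewrite gt_eqF// ltrDl.
  - by rewrite in_itv/=; apply/andP; split; lra.
move=> Tt.
have m0 : 0 < Num.min (d / 2) T by rewrite lt_min d20.
have md : Num.min (d / 2) T <= d / 2 by rewrite ge_min lexx.
have mT : Num.min (d / 2) T <= T by rewrite ge_min lexx orbT.
move: m0 md mT; set m := Num.min _ _ => m0 md mT.
apply: (hd (t - m)) => /=.
- by rewrite opprB addrC subrK gtr0_norm//; lra.
- by rewrite lt_eqF// ltrBlDr ltrDl.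
- by rewrite in_itv/=; apply/andP; split; lra.
Qed.

(** The left side consists of the terms j = 0 and j = 1 of a sum of nonnegative terms. *)
Lemma sobolev_norm_ge k (f : R -> R) :
  ('N2[f] + 'N2[wderiv f] <= sobolev_norm k.+1 f)%E.
Proof.
rewrite /sobolev_norm big_ord_recl big_ord_recl /= addeA leeDl//.
by apply: sume_ge0 => i _; exact: Lnorm_ge0.
Qed.

(** Minkowski's inequality; the difference is written as a linear combination to match
    [weak_derivative_comb]. *)
Lemma Lnorm2_sub_le (f g : R -> R) : f \in L2 -> g \in L2 ->
  ('N2[(1 *: f + (-1) *: g)] <= 'N2[f] + 'N2[g])%E.
Proof.
move=> f2 g2; have mf := Lfun2_measurable f2; have mg := Lfun2_measurable g2.
have -> : 1 *: f + (-1) *: g = f \+ (\- g).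
  by apply/funext => z; rewrite !fctE scale1r scaleN1r.
have mNg : measurable_fun setT (\- g) by exact: measurableT_comp.
have p1 : (1 <= 2%:E :> \bar R)%E by rewrite lee_fin ler1n.
apply: (le_trans (eminkowski mu mf mNg p1)).
by rewrite (oppe_Lnorm mu (EFin \o g)).
Qed.

(* Only f - g has to be continuous: this bounds a difference of two time quotients
   by their distances to the time derivative, which is known almost everywhere
   only. *)
Lemma sobolev_sub_pointwise_bound k (f g : R -> R) (x : R) :
  weakly_differentiable f -> weakly_differentiable g ->
  continuous (fun z => f z - g z) ->
  (`|f x - g x|%:E <= sobolev_norm k.+1 f + sobolev_norm k.+1 g)%E.
Proof.
move=> wf wg cfg.
have [f2 _] := wf; have [g2 _] := wg.
have [wf2 ff] := wderivP wf; have [wg2 gg] := wderivP wg.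
have d2 := Lfun2_comb 1 (-1) f2 g2.
have wd2 := Lfun2_comb 1 (-1) wf2 wg2.
have dw := weak_derivative_comb 1 (-1) f2 wf2 g2 wg2 ff gg.
have dE : 1 *: f + (-1) *: g = fun z => f z - g z.
  by apply/funext => z; rewrite !fctE scale1r scaleN1r.
have pt : lebesgue_pt (1 *: f + (-1) *: g) x.
  apply: (@continuous_lebesgue_pt _ _ _ setT) => //.
  - by split; [exact: openT|].
  - exact: Lfun2_measurable.
  - by rewrite dE; exact: cfg.
have := sobolev_pointwise_bound d2 wd2 dw pt.
rewrite {1}dE => /le_trans; apply.
apply: (le_trans (leeD (Lnorm2_sub_le f2 g2) (Lnorm2_sub_le wf2 wg2))).
by rewrite addeACA; apply: leeD; exact: sobolev_norm_ge.
Qed.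

(** The error [Q r] of the time quotient tends to 0 in H^(k+1), which controls the H^1 norm. Since
    [G t] is known only up to a null set, [Q r] cannot be evaluated at x by continuity, but
    differences of two such errors can. *)
Lemma regular_curve_dt_exists (k : nat) (T : R) (F : R -> R -> R) (t x : R) :
  0 < T -> regular_curve T k.+2 F -> t \in `[0, T] -> dt_exists T F t x.
Proof.
move=> T0 [cF sF [_ [G sG dF]]] tT.
have PF := within_itv_dnbhs_proper T0 tT.
pose Q r z := (F r z - F t z) / (r - t) - G t z.
have wQ r : r \in `[0, T] -> weakly_differentiable (Q r).
  move=> rT.
  have wF u : u \in `[0, T] -> weakly_differentiable (F u).
    by move=> uT; have [/sobolevS_weakly_differentiable] := sF u uT.
  have wG : weakly_differentiable (G t).
    by have [/sobolevS_weakly_differentiable] := sG t tT.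
  have -> : Q r = 1 *: ((r - t)^-1 *: F r + (- (r - t)^-1) *: F t) + (-1) *: G t.
    apply/funext => z; rewrite /Q !fctE /GRing.scale/=; ring.
  by apply: weakly_differentiable_comb => //; apply: weakly_differentiable_comb; exact: wF.
(* By completeness it suffices to find, for each e, one quotient, at some r0, within e of all
   quotients at r near t. *)
apply/cauchy_cvgP; apply: cauchy_exP => e e0.
have e2 : (0 < (e / 2)%:E)%E by rewrite lte_fin divr_gt0.
have near_small : \forall r \near within `[0, T] t^',
    r \in `[0, T] /\ (sobolev_norm k.+1 (Q r) < (e / 2)%:E)%E.
  near=> r; split.
    by near: r; exact: withinT.
  near: r.
  have oe : open [set y : \bar R | (y < (e / 2)%:E)%E].
    exact: open_ereal_lt_ereal.
  exact: (dF t tT _ (open_nbhs_nbhs (conj oe e2))).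
have [r0 [r0T r0e]] := filter_ex near_small.
exists (dt_quotient F t x r0).
apply: filterS near_small => r [rT re].
suff : `|dt_quotient F t x r0 - dt_quotient F t x r| < e by [].
(* The value [G t x] cancels here. *)
have -> : dt_quotient F t x r0 - dt_quotient F t x r = Q r0 x - Q r x.
  by rewrite /dt_quotient /Q; ring.
have cQ : continuous (fun z => Q r0 z - Q r z).
  have -> : (fun z => Q r0 z - Q r z) =
      (fun z => (F r0 z - F t z) / (r0 - t) - (F r z - F t z) / (r - t)).
    by apply/funext => z; rewrite /Q; ring.
  have cq u : u \in `[0, T] -> continuous (fun z => (F u z - F t z) / (u - t)).
    move=> uT z; apply: cvgM; last exact: cvg_cst.
    by apply: cvgB; exact: cF.
  by move=> z; apply: cvgB; exact: cq.
rewrite -lte_fin.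
apply: (le_lt_trans (@sobolev_sub_pointwise_bound k _ _ x (wQ _ r0T) (wQ _ rT) cQ)).
by rewrite [e]splitr EFinD; exact: lteD.
Unshelve. all: by end_near. Qed.

End TimeDerivative.

(** * Calculus of time derivatives relative to [0, T] *)

Section DtCalculus.
Context {R : realType}.

(* Extending F beyond [0, T] by a line of slope dt F turns one-sided derivatives
   at the end points into ordinary ones, so that the usual rules apply. *)
Lemma dt_extension (T : R) (F : R -> R -> R) (t x : R) :
  t \in `[0, T] -> dt_exists T F t x ->
  exists2 f : R -> R, is_derive t 1 f (dt T F t x) &
    forall r, r \in `[0, T] -> f r = F r x.
Proof.
move=> tT /cvg_ex[/= l0 Fl0]; set l := dt T F t x.
have Fl : dt_quotient F t x @ within `[0, T] t^' --> l by apply: cvgP Fl0.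
exists (fun r => if r \in `[0, T] then F r x else F t x + l * (r - t)); last first.
  by move=> r ->.
apply/is_derive_slope; rewrite tT; apply/cvgrPdist_lt => e e0.
have /cvgrPdist_lt/(_ _ e0) := Fl.
rewrite !near_withinE; apply: filterS => r hr rt; case: ifPn => rT.
  exact: hr.
by rewrite addrAC subrr add0r mulfK ?subrr ?normr0// subr_eq0.
Qed.

(** The way back from [dt_extension]: the ordinary limit restricts to the punctured neighbourhoods
    within [0, T], where it is unique. *)
Lemma dt_is_derive (T : R) (F : R -> R -> R) (t x : R) (f : R -> R) (l : R) :
  0 < T -> t \in `[0, T] -> is_derive t 1 f l ->
  (forall r, r \in `[0, T] -> f r = F r x) ->
  dt_exists T F t x /\ dt T F t x = l.
Proof.
move=> T0 tT /is_derive_slope fl fF.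
have PF := within_itv_dnbhs_proper T0 tT.
have Fl : dt_quotient F t x @ within `[0, T] t^' --> l.
  have {}fl : (f r - f t) / (r - t) @[r --> within `[0, T] t^'] --> l.
    exact: cvg_within_filter.
  apply: cvg_trans fl; apply: near_eq_cvg; near=> r.
  by rewrite /dt_quotient !fF//; near: r; exact: withinT.
by split; [apply/cvg_ex; exists l|exact: (cvg_lim (@Rhausdorff R) Fl)].
Unshelve. all: by end_near. Qed.

Lemma is_derive_add (f g : R -> R) (x a b : R) :
  is_derive x 1 f a -> is_derive x 1 g b ->
  is_derive x 1 (fun z => f z + g z) (a + b).
Proof. exact: is_deriveD. Qed.

Lemma is_derive_opp (f : R -> R) (x a : R) :
  is_derive x 1 f a -> is_derive x 1 (fun z => - f z) (- a).
Proof. exact: is_deriveN. Qed.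

Lemma is_derive_mul (f g : R -> R) (x a b : R) :
  is_derive x 1 f a -> is_derive x 1 g b ->
  is_derive x 1 (fun z => f z * g z) (a * g x + f x * b).
Proof.
move=> fa gb; apply: is_derive_eq (is_deriveM fa gb) _.
by rewrite /GRing.scale/= addrC mulrC.
Qed.

Lemma is_derive_scale (k : R) (f : R -> R) (x a : R) :
  is_derive x 1 f a -> is_derive x 1 (fun z => k * f z) (k * a).
Proof. exact: is_deriveZ. Qed.

Lemma is_derive_inv (f : R -> R) (x a : R) : f x != 0 ->
  is_derive x 1 f a -> is_derive x 1 (fun z => (f z)^-1) (- a / f x ^+ 2).
Proof.
move=> f0 fa; apply: is_derive_eq (is_deriveV f0 fa) _.
by rewrite /GRing.scale/= !mulNr mulrC.
Qed.

Lemma is_derive_sqr (f : R -> R) (x a : R) :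
  is_derive x 1 f a -> is_derive x 1 (fun z => f z ^+ 2) (2 * f x * a).
Proof.
move=> fa; apply: is_derive_eq (is_derive_mul fa fa) _; ring.
Qed.

End DtCalculus.

(** * The constitutive functions *)

Section Constitutive.
Context {R : realType}.
Implicit Types (c : coefficients R) (th : R).

Lemma derivable_is_derive (f : R -> R) (x : R) :
  derivable f x 1 -> is_derive x 1 f (derive1 f x).
Proof. by rewrite derive1E => /derivableP. Qed.

Lemma is_derive_derive1 (f : R -> R) (x l : R) :
  is_derive x 1 f l -> derive1 f x = l.
Proof. by rewrite derive1E => -[]. Qed.

Lemma smooth_is_derive (f : R -> R) (x : R) :
  smooth_on_positives f -> 0 < x -> is_derive x 1 f (derive1 f x).
Proof. by move=> sf x0; apply: derivable_is_derive; exact: (sf 0%N x). Qed.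

Lemma smooth_is_derive1 (f : R -> R) (x : R) :
  smooth_on_positives f -> 0 < x ->
  is_derive x 1 (derive1 f) (derive1 (derive1 f) x).
Proof. by move=> sf x0; apply: derivable_is_derive; exact: (sf 1%N x). Qed.

Lemma derivable_Zfun c th : admissible c -> 0 < th -> derivable (Zfun c) th 1.
Proof.
move=> hc th0; have k0 := gt_eqF (kappa_gt0 hc th0).
have dt := smooth_is_derive (tau1_smooth hc) th0.
have dk := smooth_is_derive (kappa_smooth hc) th0.
by have [] := is_derive_mul dt (is_derive_inv (negbT k0) dk).
Qed.

(** The quotient rule gives Z' as the explicit expression [Z1] at positive arguments only, but these
    include a neighbourhood of th, which is enough to differentiate once more. *)
Lemma derivable_derive1_Zfun c th : admissible c -> 0 < th ->
  derivable (derive1 (Zfun c)) th 1.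
Proof.
move=> hc th0; have k0 := negbT (gt_eqF (kappa_gt0 hc th0)).
have dt := smooth_is_derive (tau1_smooth hc) th0.
have dk := smooth_is_derive (kappa_smooth hc) th0.
have ddt := smooth_is_derive1 (tau1_smooth hc) th0.
have ddk := smooth_is_derive1 (kappa_smooth hc) th0.
pose Z1 z := derive1 (tau1 c) z * (kappa c z)^-1 +
  tau1 c z * (- derive1 (kappa c) z * (kappa c z ^+ 2)^-1).
have dZ1 : derivable Z1 th 1.
  have := is_derive_add (is_derive_mul ddt (is_derive_inv k0 dk))
    (is_derive_mul dt (is_derive_mul (is_derive_opp ddk)
      (is_derive_inv (f := fun z => kappa c z ^+ 2) _ (is_derive_sqr dk)))).
  by rewrite expf_neq0// => /(_ isT)[].
apply: near_eq_derivable dZ1; near=> z.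
have z0 : 0 < z by near: z; exact: lt_nbhsr.
have kz := negbT (gt_eqF (kappa_gt0 hc z0)).
have dtz := smooth_is_derive (tau1_smooth hc) z0.
have dkz := smooth_is_derive (kappa_smooth hc) z0.
by rewrite (is_derive_derive1 (is_derive_mul dtz (is_derive_inv kz dkz))).
Unshelve. all: by end_near. Qed.

Lemma is_derive_afun c th : admissible c -> 0 < th ->
  is_derive th 1 (afun c)
    (derive1 (Zfun c) th / th - Zfun c th / th ^+ 2 -
     2^-1 * derive1 (derive1 (Zfun c)) th).
Proof.
move=> hc th0; have th0' := negbT (gt_eqF th0).
have dZ := derivable_is_derive (derivable_Zfun hc th0).
have ddZ := derivable_is_derive (derivable_derive1_Zfun hc th0).
have dE := is_derive_add
  (is_derive_mul dZ (is_derive_inv th0' (is_derive_id th 1)))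
  (is_derive_opp (is_derive_scale 2^-1 ddZ)).
apply: is_derive_eq dE _; rewrite /=.
by field.
Qed.

(** Convertible to the factor of q^2 in [entropy]; as a function of its own it can be composed with
    theta. *)
Definition entropy_coef c th : R := derive1 (fun y => Zfun c y / (2 * y)) th.

Lemma entropy_coefE c th : admissible c -> 0 < th ->
  entropy_coef c th =
  derive1 (Zfun c) th * (2 * th)^-1 - Zfun c th * (2 * th ^+ 2)^-1.
Proof.
move=> hc th0; have th0' := negbT (gt_eqF th0).
have dZ := derivable_is_derive (derivable_Zfun hc th0).
have th2 : 2 * th != 0 by rewrite mulf_neq0.
have d2 := is_derive_scale 2 (is_derive_id th 1).
apply: is_derive_derive1.
apply: is_derive_eq (is_derive_mul dZ (is_derive_inv th2 d2)) _.
by field.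
Qed.

(** The closed form [entropy_coefE] holds on a neighbourhood of th, so it can be differentiated
    instead. *)
Lemma is_derive_entropy_coef c th : admissible c -> 0 < th ->
  is_derive th 1 (entropy_coef c)
    (derive1 (derive1 (Zfun c)) th / (2 * th) - derive1 (Zfun c) th / th ^+ 2 +
     Zfun c th / th ^+ 3).
Proof.
move=> hc th0; have th0' := negbT (gt_eqF th0).
have dZ := derivable_is_derive (derivable_Zfun hc th0).
have ddZ := derivable_is_derive (derivable_derive1_Zfun hc th0).
have th2 : 2 * th != 0 by rewrite mulf_neq0.
have ths : 2 * th ^+ 2 != 0 by rewrite mulf_neq0// expf_neq0.
have d1 := is_derive_scale 2 (is_derive_id th 1).
have d2 := is_derive_scale 2 (is_derive_sqr (is_derive_id th 1)).
have dE := is_derive_add (is_derive_mul ddZ (is_derive_inv th2 d1))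
  (is_derive_opp (is_derive_mul dZ (is_derive_inv (f := fun z => 2 * z ^+ 2) ths d2))).
have {}dE := near_eq_is_derive _ dE.
apply: is_derive_eq (dE _ _) _.
  near=> z; have z0 : 0 < z by near: z; exact: lt_nbhsr.
  by rewrite (entropy_coefE hc z0).
by field.
Unshelve. all: by end_near. Qed.

(** Stated for functions of one variable, the formula serves twice: in x, and in t along the
    extensions given by [dt_extension]. *)
Lemma is_derive_energy_density c (r u th q S : R -> R) (y r' u' th' q' S' : R) :
  admissible c -> 0 < th y ->
  is_derive y 1 r r' -> is_derive y 1 u u' -> is_derive y 1 th th' ->
  is_derive y 1 q q' -> is_derive y 1 S S' ->
  is_derive y 1 (fun z => 2^-1 * r z * u z ^+ 2
      + tau2 c / (2 * mu c) * r z * S z ^+ 2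
      + r z * (Cv c * th z + afun c (th z) * q z ^+ 2))
    (2^-1 * (r' * u y ^+ 2 + 2 * r y * u y * u')
      + tau2 c / (2 * mu c) * (r' * S y ^+ 2 + 2 * r y * S y * S')
      + r' * (Cv c * th y + afun c (th y) * q y ^+ 2)
      + r y * (Cv c * th' + 2 * afun c (th y) * q y * q' +
         (derive1 (Zfun c) (th y) / th y - Zfun c (th y) / th y ^+ 2 -
          2^-1 * derive1 (derive1 (Zfun c)) (th y)) * th' * q y ^+ 2)).
Proof.
move=> hc th0 dr du dth dq dS.
have da := is_derive1_comp (is_derive_afun hc th0) dth.
apply: is_derive_eq (is_derive_add (is_derive_add
  (is_derive_mul (is_derive_scale 2^-1 dr) (is_derive_sqr du))
  (is_derive_mul (is_derive_scale (tau2 c / (2 * mu c)) dr) (is_derive_sqr dS)))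
  (is_derive_mul dr (is_derive_add (is_derive_scale (Cv c) dth)
    (is_derive_mul da (is_derive_sqr dq))))) _.
rewrite /=; ring.
Qed.

Lemma is_derive_entropy_density c (r th q : R -> R) (y r' th' q' : R) :
  admissible c -> 0 < r y -> 0 < th y ->
  is_derive y 1 r r' -> is_derive y 1 th th' -> is_derive y 1 q q' ->
  is_derive y 1 (fun z => Cv c * ln (th z) - Rgas c * ln (r z)
      - entropy_coef c (th z) * q z ^+ 2)
    (Cv c * th' / th y - Rgas c * r' / r y
     - 2 * (derive1 (Zfun c) (th y) * (2 * th y)^-1 -
            Zfun c (th y) * (2 * th y ^+ 2)^-1) * q y * q'
     - (derive1 (derive1 (Zfun c)) (th y) / (2 * th y) -
        derive1 (Zfun c) (th y) / th y ^+ 2 + Zfun c (th y) / th y ^+ 3)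
       * th' * q y ^+ 2).
Proof.
move=> hc r0 th0 dr dth dq.
have db := is_derive1_comp (is_derive_entropy_coef hc th0) dth.
have dlr := is_derive1_comp (is_derive1_ln r0) dr.
have dlth := is_derive1_comp (is_derive1_ln th0) dth.
apply: is_derive_eq (is_derive_add (is_derive_add
  (is_derive_scale (Cv c) dlth)
  (is_derive_opp (is_derive_scale (Rgas c) dlr)))
  (is_derive_opp (is_derive_mul db (is_derive_sqr dq)))) _.
rewrite /= entropy_coefE//; ring.
Qed.

End Constitutive.

(* The terms in q^2 th' cancel because a' / th + b' = 0, and
   a / th + b = Z / (2 th^2) turns q q' into the heat flux equation. *)
Lemma entropy_identity (K : realFieldType)
    (r u th q S rt ut tht qt St rx ux thx qx Sx : K)
    (t1 k t2 m cv rg Z1 Z2 eta : K) :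
  r != 0 -> th != 0 -> k != 0 -> m != 0 ->
  let Z := t1 / k in
  let a := Z / th - 2^-1 * Z1 in
  let a' := Z1 / th - Z / th ^+ 2 - 2^-1 * Z2 in
  let b := Z1 * (2 * th)^-1 - Z * (2 * th ^+ 2)^-1 in
  let b' := Z2 / (2 * th) - Z1 / th ^+ 2 + Z / th ^+ 3 in
  let E := 2^-1 * r * u ^+ 2 + t2 / (2 * m) * r * S ^+ 2 +
    r * (cv * th + a * q ^+ 2) in
  let dE := fun r' u' th' q' S' =>
    2^-1 * (r' * u ^+ 2 + 2 * r * u * u') +
    t2 / (2 * m) * (r' * S ^+ 2 + 2 * r * S * S') +
    r' * (cv * th + a * q ^+ 2) +
    r * (cv * th' + 2 * a * q * q' + a' * th' * q ^+ 2) in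
  let deta := fun r' th' q' =>
    cv * th' / th - rg * r' / r - 2 * b * q * q' - b' * th' * q ^+ 2 in
  let p := rg * r * th in
  let px := rg * rx * th + rg * r * thx in
  rt + (rx * u + r * ux) = 0 ->
  r * ut + r * u * ux + px = Sx ->
  dE rt ut tht qt St + ((ux * E + u * dE rx ux thx qx Sx) + (px * u + p * ux) +
    qx - (Sx * u + S * ux)) = 0 ->
  t1 * (r * qt + r * u * qx) + q + k * thx = 0 ->
  t2 * (r * St + r * u * Sx) + S = m * ux ->
  rt * eta + r * deta rt tht qt +
    (((rx * u + r * ux) * eta + r * u * deta rx thx qx) +
     (qx / th + q * (- thx / th ^+ 2))) =
  q ^+ 2 / (k * th ^+ 2) + S ^+ 2 / (m * th).
Proof.
move=> r0 th0 k0 m0 Z a a' b b' E dE deta p px M /eqP; rewrite -subr_eq0.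
move=> /eqP P N H /eqP; rewrite -subr_eq0 => /eqP W.
apply/eqP; rewrite -subr_eq0; apply/eqP.
(* The difference of the two sides is a combination of the five equations. The energy balance is
   divided by th; the multipliers -u / th, -S / (m th) and -q / (k th^2) remove the kinetic, stress
   and heat flux parts. The mass equation absorbs eta, the term -rg from ln rho and p u_x, and the
   energy per unit mass over th. *)
transitivity (
  (rt + (rx * u + r * ux)) * (eta - rg - (u ^+ 2 / 2 + t2 / (2 * m) * S ^+ 2 +
    (cv * th + a * q ^+ 2)) / th)
  + (dE rt ut tht qt St + ((ux * E + u * dE rx ux thx qx Sx) + (px * u + p * ux)
    + qx - (Sx * u + S * ux))) / th
  - u / th * (r * ut + r * u * ux + px - Sx)
  - S / (m * th) * (t2 * (r * St + r * u * Sx) + S - m * ux)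
  - q / (k * th ^+ 2) * (t1 * (r * qt + r * u * qx) + q + k * thx)); last first.
  by rewrite M N P H W !mulr0 !mul0r !subr0 addr0.
rewrite /deta /dE /E /p /px /b /b' /a /a' /Z; field.
by rewrite r0 th0 k0 m0.
Qed.

(** * Classical first derivatives of the unknowns *)

Section RegularCurve.
Context {R : realType}.

Lemma regular_curve_derivable (k : nat) (T : R) (F : R -> R -> R) (t x : R) :
  regular_curve T k.+2 F -> t \in `[0, T] -> derivable (F t) x 1.
Proof.
move=> [cF sF _] tT; apply: (@sobolevSS_derivable _ k); first exact: cF.
by have [] := sF t tT.
Qed.

(** Only rho - 1 and theta - 1 are Sobolev curves; the constant drops out of both difference
    quotients. *)
Lemma regular_curve_shift (k : nat) (T a : R) (F : R -> R -> R) (t x : R) :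
  0 < T -> regular_curve T k.+2 (fun t x => F t x - a) -> t \in `[0, T] ->
  dt_exists T F t x /\ derivable (F t) x 1.
Proof.
move=> T0 rF tT; split.
  have := @regular_curve_dt_exists _ k T _ t x T0 rF tT.
  rewrite /dt_exists (_ : dt_quotient _ t x = dt_quotient F t x)//.
  by apply/funext => r; rewrite /dt_quotient opprB addrA subrK.
have dF := @regular_curve_derivable k T _ t x rF tT.
rewrite (_ : F t = (fun y => F t y - a) + cst a).
  exact: derivableD dF (derivable_cst a x 1).
by apply/funext => y; rewrite fctE subrK.
Qed.

End RegularCurve.

(** * The entropy balance *)

Unset Implicit Arguments.

Theorem lemma3p1 (R : realType) (c : coefficients R) (hc : admissible c)
    (s : nat) (hs : (2 <= s)%N) (T : R) (hT : 0 < T)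
    (rho u theta q S : R -> R -> R)
    (hsol : local_solution c s T rho u theta q S) :
  let eta := entropy c rho theta q in
  let density := fun t x => rho t x * eta t x in
  let flux := fun t x => rho t x * u t x * eta t x + q t x / theta t x in
  forall t x : R, t \in `[0, T] ->
    [/\ dt_exists T density t x,
        derivable (flux t) x 1 &
        dt T density t x + dx flux t x =
          q t x ^+ 2 / (kappa c (theta t x) * theta t x ^+ 2)
          + S t x ^+ 2 / (mu c * theta t x)].
Proof.
(* With s = 0 and s = 1 excluded, s has the form k + 2 of the regularity lemmas. *)
case: s hs hsol => [//|[//|k]] _ hsol eta density flux t x tT.
have r0 := sol_rho_gt0 hsol x tT.
have th0 := sol_theta_gt0 hsol x tT.
have [eqM eqP eqE eqH eqS] := sol_equations hsol x tT.
have [trho xrho] := regular_curve_shift x hT (sol_rho hsol) tT.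
have [tth xth] := regular_curve_shift x hT (sol_theta hsol) tT.
have tu : dt_exists T u t x := regular_curve_dt_exists hT (sol_u hsol) tT.
have tq : dt_exists T q t x := regular_curve_dt_exists hT (sol_q hsol) tT.
have tS : dt_exists T S t x := regular_curve_dt_exists hT (sol_S hsol) tT.
have xu : derivable (u t) x 1 := regular_curve_derivable (sol_u hsol) tT.
have xq : derivable (q t) x 1 := regular_curve_derivable (sol_q hsol) tT.
have xS : derivable (S t) x 1 := regular_curve_derivable (sol_S hsol) tT.
have {xrho}drx := derivable_is_derive xrho.
have {xu}dux := derivable_is_derive xu.
have {xth}dthx := derivable_is_derive xth.
have {xq}dqx := derivable_is_derive xq.
have {xS}dSx := derivable_is_derive xS.
(* At fixed x, the functions r, v, th, p, W of time extend rho, u, theta, q, S beyond [0, T]; here p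
   is the heat flux and W the stress. *)
have [r drt rE] := dt_extension tT trho.
have [v dvt vE] := dt_extension tT tu.
have [th dtht thE] := dt_extension tT tth.
have [p dpt pE] := dt_extension tT tq.
have [W dWt WE] := dt_extension tT tS.
have rt0 : 0 < r t by rewrite rE.
have tht0 : 0 < th t by rewrite thE.
have detat := is_derive_entropy_density hc rt0 tht0 drt dtht dpt.
have detax := is_derive_entropy_density hc r0 th0 drx dthx dqx.
have densityE y : y \in `[0, T] -> r y * (Cv c * ln (th y) - Rgas c * ln (r y) -
    entropy_coef c (th y) * p y ^+ 2) = density y x.
  by move=> yT; rewrite rE ?thE ?pE.
have [exd dtd] := dt_is_derive hT tT (is_derive_mul drt detat) densityE.
have dEt := is_derive_energy_density hc tht0 drt dvt dtht dpt dWt.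
have dEx := is_derive_energy_density hc th0 drx dux dthx dqx dSx.
have energyE y : y \in `[0, T] -> 2^-1 * r y * v y ^+ 2 +
    tau2 c / (2 * mu c) * r y * W y ^+ 2 +
    r y * (Cv c * th y + afun c (th y) * p y ^+ 2) =
    total_energy c rho u theta q S y x.
  by move=> yT; rewrite rE ?vE ?thE ?pE ?WE.
have [_ dtE] := dt_is_derive hT tT dEt energyE.
have dpx := is_derive_mul (is_derive_scale (Rgas c) drx) dthx.
have dflux := is_derive_add (is_derive_mul (is_derive_mul drx dux) detax)
  (is_derive_mul dqx (is_derive_inv (negbT (gt_eqF th0)) dthx)).
have dEflux := is_derive_add (is_derive_add (is_derive_add
  (is_derive_mul dux dEx) (is_derive_mul dpx dux)) dqx)
  (is_derive_opp (is_derive_mul dSx dux)).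
have xflux : derivable (flux t) x 1 by have [] := dflux.
split; [exact: exd|exact: xflux|].
have fluxE : dx flux t x = _ := is_derive_derive1 dflux.
have EfluxE : dx (fun t x => u t x * total_energy c rho u theta q S t x
    + pressure c rho theta t x * u t x + q t x - S t x * u t x) t x = _ :=
  is_derive_derive1 dEflux.
have presE : dx (pressure c rho theta) t x = _ := is_derive_derive1 dpx.
have massE : dx (fun t x => rho t x * u t x) t x = _ :=
  is_derive_derive1 (is_derive_mul drx dux).
rewrite dtd fluxE {dtd fluxE}.
move: eqM eqP eqE eqH eqS; rewrite massE presE EfluxE dtE.
rewrite rE// thE// pE// vE// WE//.
(* Folding the computed derivatives back into [dx] makes the five equations instances of the
   hypotheses of [entropy_identity], where eta is an arbitrary number. *)
rewrite -/(dx rho t x) -/(dx u t x) -/(dx theta t x) -/(dx q t x) -/(dx S t x).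
have nz := fun (y : R) (y0 : 0 < y) => negbT (gt_eqF y0).
have id := @entropy_identity R (rho t x) (u t x) (theta t x) (q t x) (S t x)
  (dt T rho t x) (dt T u t x) (dt T theta t x) (dt T q t x) (dt T S t x)
  (dx rho t x) (dx u t x) (dx theta t x) (dx q t x) (dx S t x)
  (tau1 c (theta t x)) (kappa c (theta t x)) (tau2 c) (mu c) (Cv c) (Rgas c)
  (derive1 (Zfun c) (theta t x)) (derive1 (derive1 (Zfun c)) (theta t x))
  (eta t x) (nz _ r0) (nz _ th0) (nz _ (kappa_gt0 hc th0)) (nz _ (mu_gt0 hc)).
move=> eqM eqP eqE eqH eqS.
exact: id eqM eqP eqE eqH eqS.
Qed.
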